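(* Let $\Gamma$, $\Sigma$ and $\Delta$ be graphs with the following properties. (i) $\Gamma$ is locally $\Sigma$, and every $\mu$-graph of $\Sigma$ is isomorphic to $\Delta$. (ii) $\Sigma$ is strongly regular with $\lambda(\Sigma)=\mu(\Sigma)-2$. (iii) $\Delta$ has diameter $3$ with $k_1(\Delta)=k_2(\Delta)$ and $k_3(\Delta)=1$. (iv) For any distinct non-adjacent $y,z\in V\Sigma$, if $v$ and $x$ are vertices at distance $3$ in the graph induced by $\Sigma(y)\cap\Sigma(z)$, then $y$ and $z$ are at distance $3$ in the graph induced by $\Sigma(v)\cap\Sigma(x)$. Then $\Gamma$ has the unique $x$ property.
   Context: All graphs are undirected and simple with non-empty vertex set $V\Gamma$. For $u\in V\Gamma$, $\Gamma_i(u)$ is the set of vertices at distance $i$ from $u$, and $\Gamma(u)=\Gamma_1(u)$. The notation $k_i(\Delta)$ denotes $|\Delta_i(y)|$ and indicates the assumption that this number does not depend on the choice of vertex $y$ of $\Delta$. A graph $\Gamma$ is locally $\Sigma$ if the neighbourhood of every vertex of $\Gamma$ is non-empty and induces a graph isomorphic to $\Sigma$. A strongly regular graph with parameters $(v,k,\lambda,\mu)$ is a finite graph of order $v$, regular of valency $k$ with $0<k<v-1$, in which any two adjacent vertices have $\lambda=\lambda(\Sigma)$ common neighbours and any two distinct non-adjacent vertices have $\mu=\mu(\Sigma)$ common neighbours. A $\mu$-graph of $\Sigma$ is a subgraph induced by $\Sigma(u)\cap\Sigma(w)$ for some vertices $u,w$ at distance two in $\Sigma$. A non-complete graph $\Gamma$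 has the unique $x$ property if for some $u\in V\Gamma$, $v\in\Gamma(u)$ and $w\in\Gamma_2(u)\cap\Gamma(v)$, there exists a unique $x\in\Gamma(u)\cap\Gamma_2(v)$ such that $\Gamma(u)\cap\Gamma(v)\cap\Gamma(w)=\Gamma(u)\cap\Gamma(v)\cap\Gamma(x)$. *)

(* Defs.v *)
From mathcomp Require Import all_boot.
From mathcomp Require Import boolp classical_sets functions cardinality.

Set Implicit Arguments.
Unset Strict Implicit.
Unset Printing Implicit Defensive.

Local Open Scope classical_set_scope.
Local Open Scope card_scope.

(* The vertex set may be infinite, and may be empty (so that every vertex set
   induces a graph); non-emptiness is a separate hypothesis. *)
Record graph : Type := Graph {
  vertex :> Type;
  adj : rel vertex;
  adj_sym : symmetric adj;
  adj_irr : irreflexive adj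
}.

Definition nonempty_graph (G : graph) : Prop := [set: G] !=set0.

Definition complete_graph (G : graph) : Prop := forall x y : G, x <> y -> adj x y.

Definition isomorphic (G H : graph) : Prop :=
  exists f : G -> H, bijective f /\ forall x y : G, adj (f x) (f y) = adj x y.

Section Induced.
Variables (G : graph) (A : set G).

Let ind_adj : rel A := fun x y => adj (set_val x) (set_val y).

Fact ind_adj_sym : symmetric ind_adj.
Proof. by move=> x y; exact: adj_sym. Qed.

Fact ind_adj_irr : irreflexive ind_adj.
Proof. by move=> x; exact: adj_irr. Qed.

Definition induced : graph := Graph ind_adj_sym ind_adj_irr.

End Induced.

Definition walk (G : graph) (n : nat) (x y : G) : Prop :=
  exists p : seq G, [/\ path (@adj G) x p, last x p = y & size p = n].

Definition at_dist (G : graph) (n : nat) (x y : G) : Prop :=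
  walk n x y /\ forall m : nat, m < n -> ~ walk m x y.

Definition at_dist_in (G : graph) (A : set G) (n : nat) (x y : G) : Prop :=
  exists x' y' : induced A,
    [/\ set_val x' = x, set_val y' = y & at_dist n x' y'].

Definition sphere (G : graph) (i : nat) (u : G) : set G :=
  [set w | at_dist i u w].

Definition nbr (G : graph) (u : G) : set G := [set w | adj u w].

Lemma sphere1 (G : graph) (u : G) : sphere 1 u = nbr u.
Proof.
apply/seteqP; split=> w.
  by case=> -[[|a [|b p]] [//= /andP[uw _] <- _]] _.
move=> uw; split; first by exists [:: w]; split=> //=; rewrite andbT.
move=> [|m] // _ [[|a p] [] //= _ uwE _].
by move: uw; rewrite /nbr /= -uwE adj_irr.
Qed.

Definition diameter (G : graph) (d : nat) : Prop :=
  (forall x y : G, exists2 i, i <= d & at_dist i x y) /\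
  (exists x y : G, at_dist d x y).

(* k_i(G) is defined and equal to n *)
Definition has_k (G : graph) (i n : nat) : Prop :=
  forall y : G, sphere i y #= `I_n.

Definition locally (G S : graph) : Prop :=
  forall u : G, nbr u !=set0 /\ isomorphic (induced (nbr u)) S.

Definition mu_graphs_isomorphic_to (S D : graph) : Prop :=
  forall u w : S, at_dist 2 u w -> isomorphic (induced (nbr u `&` nbr w)) D.

Definition strongly_regular (G : graph) (v k lambda mu : nat) : Prop :=
  [/\ [set: G] #= `I_v,
      0 < k < v.-1,
      forall x : G, nbr x #= `I_k,
      forall x y : G, adj x y -> nbr x `&` nbr y #= `I_lambda &
      forall x y : G, x <> y -> ~~ adj x y -> nbr x `&` nbr y #= `I_mu].

Definition unique_x_property (G : graph) : Prop :=
  ~ complete_graph G /\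
  exists u v w : G,
    [/\ nbr u v,
        (sphere 2 u `&` nbr v) w &
        exists! x : G, (nbr u `&` sphere 2 v) x /\
          nbr u `&` nbr v `&` nbr w = nbr u `&` nbr v `&` nbr x].

(* Main.v *)
Require Import Defs.
From mathcomp Require Import all_boot.
From mathcomp Require Import finmap.
From mathcomp Require Import boolp classical_sets functions cardinality.

Set Implicit Arguments.
Unset Strict Implicit.
Unset Printing Implicit Defensive.

Local Open Scope classical_set_scope.

(* Let D = G(u) & G(v) & G(w), a copy of Delta of order mu = lambda + 2, so
   that lambda = 2n with n = k_1(Delta) = k_2(Delta); then D is the disjoint
   union of {c, d}, D(c) and D(d) for every antipodal pair c, d.  Let x be the
   antipode of v in G(u) & G(c) & G(d), and E = G(u) & G(v) & G(x); by (iv), c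
   and d are antipodal in E too.  In G(u) & G(v) the vertex c has 2n neighbours,
   n of which are adjacent to d; none of these lies in D or E, so both D(c) and
   E(c) consist of the n others.  Likewise D(d) = E(d), hence D = E.
   Conversely, by (iv) any x with D = E is the antipode of v. *)

(** * Cardinalities of finite sets *)

Lemma card_setU_disjoint (T : Type) (A B : set T) (m n : nat) :
  A `&` B = set0 -> (A #= `I_m)%card -> (B #= `I_n)%card ->
  (A `|` B #= `I_(m + n))%card.
Proof.
move=> AB0 Am Bn.
have finA : finite_set A by apply/finite_setP; exists m.
have finB : finite_set B by apply/finite_setP; exists n.
apply/(@fcard_eq {classic T} nat); [by rewrite finite_setU|exact: finite_II|].
have /= := @card_fset_set nat `I_(m + n) (m + n) (card_eqxx _) => ->.
rewrite fset_setU// cardfsU -fset_setI// AB0 fset_set0 cardfs0 subn0.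
by rewrite (@card_fset_set {classic T} _ m)// (@card_fset_set {classic T} _ n).
Qed.

Lemma card_subset_eq (T : Type) (A B : set T) (n : nat) :
  A `<=` B -> (A #= `I_n)%card -> (B #= `I_n)%card -> A = B.
Proof.
move=> AB An Bn.
have finA : finite_set A by apply/finite_setP; exists n.
have finB : finite_set B by apply/finite_setP; exists n.
apply: (@fset_set_inj {classic T}) => //; apply/eqP.
rewrite eqEfcard (@card_fset_set {classic T} _ n)//.
by rewrite (@card_fset_set {classic T} _ n)// leqnn andbT -fset_set_sub.
Qed.

Lemma card_succ_nonempty (T : Type) (A : set T) (n : nat) :
  (A #= `I_n.+1)%card -> A !=set0.
Proof.
move=> An; apply/set0P/eqP => A0; rewrite A0 card_eq_sym card_eq0 in An.
by move/eqP: An => /seteqP[/(_ 0 isT)].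
Qed.

Lemma card1_set1 (T : Type) (A : set T) : (A #= `I_1)%card -> exists a, A = [set a].
Proof.
move=> A1; have [a Aa] := card_succ_nonempty A1; exists a.
by apply/esym/(card_subset_eq _ card_set1 A1) => _ ->.
Qed.

(** By counting, [B] and [C] both have to be the complement of [A] in [N]. *)
Lemma eq_card_complement (T : Type) (N A B C : set T) (m n : nat) :
  (N #= `I_(m + n))%card -> (A #= `I_m)%card ->
  (B #= `I_n)%card -> (C #= `I_n)%card ->
  A `<=` N -> B `<=` N -> C `<=` N ->
  A `&` B = set0 -> A `&` C = set0 -> B = C.
Proof.
move=> Nmn Am Bn Cn AN BN CN AB AC.
have E X : (X #= `I_n)%card -> X `<=` N -> A `&` X = set0 -> X = N `\` A.
  move=> Xn XN AX.
  have <- : A `|` X = N.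
    apply: card_subset_eq Nmn; first by rewrite subUset.
    exact: card_setU_disjoint.
  apply/seteqP; split=> [t Xt|t [[]]//].
  by split; [right|move=> At; have : (A `&` X) t by []; rewrite AX].
by rewrite (E B)// -(E C).
Qed.

(** * Distance three in an induced subgraph *)

Section Distance3.
Variable G : graph.
Implicit Types (A : set G) (x y : G).

(** Distance 3 in the subgraph induced by [A], phrased with vertices of [G] so that no subset type
    stands in the way when [A] is rewritten or mapped to another graph. *)
Definition dist3 A x y : Prop :=
  [/\ A x /\ A y, x <> y, ~~ adj x y,
      forall z, A z -> adj x z -> ~~ adj z y &
      exists z t, [/\ A z, A t, adj x z, adj z t & adj t y]].

Lemma dist3_sym A x y : dist3 A x y -> dist3 A y x.
Proof.
move=> [[Ax Ay] xy nxy n2 [z [t [Az At xz zt ty]]]]; split=> //.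
- by move=> yx; apply: xy.
- by rewrite adj_sym.
- by move=> s As ys; apply/negP => sx; move: (n2 s As);
    rewrite adj_sym sx => /(_ isT); rewrite adj_sym ys.
- by exists t, z; split=> //; rewrite adj_sym.
Qed.

Lemma at_dist3P x y : at_dist 3 x y <-> dist3 setT x y.
Proof.
split.
  move=> [[[|z [|t [|s [|? ?]]]] [//= /and4P[xz zt ts _] <- _]] n3]; split=> //.
  - by move=> xs; apply: (n3 0) => //; exists [::].
  - by apply/negP => xs; apply: (n3 1) => //; exists [:: s]; rewrite /= xs.
  - move=> r _ xr; apply/negP => rs; apply: (n3 2) => //.
    by exists [:: r; s]; rewrite /= xr rs.
  - by exists z, t.
move=> [_ xy nxy n2 [z [t [_ _ xz zt ty]]]]; split.
  by exists [:: z; t; y]; rewrite /= xz zt ty.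
move=> [|[|[|]]]// _ [[|a [|b [|? ?]]] []]//=.
  by rewrite andbT => xa ay; rewrite -ay xa in nxy.
by move=> /and3P[xa ab _] by_; move: (n2 a I xa); rewrite -by_ ab.
Qed.

End Distance3.

(** * Copies of a graph inside another, and antipodal sets *)

Definition embedding (H G : graph) (e : H -> G) : Prop :=
  injective e /\ forall x y, adj (e x) (e y) = adj x y.

(** With a map into [G] itself, vertex sets of [H] are transported as images, and iterated local
    structure becomes intersections of neighbourhoods in [G]. *)
Lemma embedding_of_isomorphic (G H : graph) (A : set G) :
  isomorphic (induced A) H -> exists2 e : H -> G, embedding e & range e = A.
Proof.
move=> [f [[g fK gK] fadj]]; exists (fun x => set_val (g x)).
  split=> [x y /val_inj /(can_inj gK)//|x y].
  by rewrite -[in RHS](gK x) -[in RHS](gK y) fadj.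
apply/seteqP; split=> [_ [x _ <-]|x Ax]; first exact: set_valP.
by exists (f (SigSub (mem_set Ax))); rewrite // fK.
Qed.

Lemma embedding_comp (G H K : graph) (e : H -> G) (f : K -> H) :
  embedding e -> embedding f -> embedding (e \o f).
Proof.
by move=> [ei ea] [fi fa]; split=> [x y /ei /fi|x y /=]//; rewrite ea fa.
Qed.

Section Embedding.
Variables (G H : graph) (e : H -> G).
Hypothesis eP : embedding e.

Lemma embedding_setI_nbr (A : set H) (x : H) :
  e @` (A `&` nbr x) = e @` A `&` nbr (e x).
Proof.
have [_ eadj] := eP; apply/seteqP; split=> y.
  by move=> [z [Az xz] <-]; split; [exists z|rewrite /nbr /= eadj].
by move=> [[z Az <-]]; rewrite /nbr /= eadj => xz; exists z.
Qed.

Lemma card_embedding (A : set H) (n : nat) :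
  (e @` A #= `I_n)%card = (A #= `I_n)%card.
Proof. by apply: card_eql; apply: inj_card_eq => x y _ _; apply: eP.1. Qed.

Lemma embedding_dist3 (A : set H) (x y : H) :
  dist3 (e @` A) (e x) (e y) <-> dist3 A x y.
Proof.
have [einj eadj] := eP.
have eA z : (e @` A) (e z) <-> A z.
  by split=> [[t At /einj <-]//|Az]; exists z.
split=> -[[Ax Ay] xy nxy n2 [z [t [Az At xz zt ty]]]].
  move: Az At xz zt ty => [z' Az' <-] [t' At' <-]; rewrite !eadj => xz zt ty.
  split; [by split; apply/eA|by move=> xyE; rewrite xyE in xy|by rewrite -eadj| |].
    by move=> s As xs; rewrite -eadj; apply: n2; [apply/eA|rewrite eadj].
  by exists z', t'.
split; [by split; apply/eA|by move/einj|by rewrite eadj| |].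
  by move=> _ [s As <-]; rewrite !eadj; exact: n2.
by exists (e z), (e t); rewrite !eadj; split=> //; apply/eA.
Qed.

End Embedding.

(** The inclusion of the induced subgraph is an embedding with range [A], which reduces the claim to
    the case of a whole graph. *)
Lemma at_dist_in3P (G : graph) (A : set G) (x y : G) :
  at_dist_in A 3 x y <-> dist3 A x y.
Proof.
have valP : embedding (set_val : induced A -> G).
  by split=> // s t /val_inj.
have rangeA : range (set_val : induced A -> G) = A.
  apply/seteqP; split=> [_ [z _ <-]|z Az]; first exact: set_valP.
  by exists (SigSub (mem_set Az)).
split=> [[x' [y' [<- <- /at_dist3P]]]|d].
  by move/(embedding_dist3 valP); rewrite rangeA.
have [[Ax Ay] _ _ _ _] := d.
exists (SigSub (mem_set Ax)), (SigSub (mem_set Ay)); split=> //.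
by apply/at_dist3P/(embedding_dist3 valP); rewrite rangeA.
Qed.

(** What condition (iii) yields for a copy of Delta with vertex set [A]: valency [n], a unique
    antipode for each vertex, and a covering by the closed neighbourhoods of any antipodal pair. *)
Definition antipodal (G : graph) (n : nat) (A : set G) : Prop :=
  [/\ A !=set0,
      forall x, A x -> (A `&` nbr x #= `I_n)%card,
      forall x, A x -> exists! y, dist3 A x y &
      forall x y, dist3 A x y -> A = (x |` (A `&` nbr x)) `|` (y |` (A `&` nbr y))].

Lemma antipodal_embedding (G H : graph) (e : H -> G) (n : nat) (A : set H) :
  embedding e -> antipodal n A -> antipodal n (e @` A).
Proof.
move=> eP [A0 An A3 AU]; split.
- by have [a Aa] := A0; exists (e a), a.
- by move=> _ [x Ax <-]; rewrite -embedding_setI_nbr// card_embedding//; exact: An.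
- move=> _ [x Ax <-]; have [y [xy yU]] := A3 x Ax; exists (e y).
  split; first exact/embedding_dist3.
  move=> z xz; have [[_ [z' Az' z'E]] _ _ _ _] := xz.
  by move: xz; rewrite -z'E => /(embedding_dist3 eP)/yU <-.
- move=> x y xy; have [[[x' Ax' x'E] [y' Ay' y'E]] _ _ _ _] := xy.
  move: xy; rewrite -x'E -y'E => /(embedding_dist3 eP)/AU {1}->.
  by rewrite !image_setU !image_set1 !embedding_setI_nbr.
Qed.

(** The two closed neighbourhoods that cover [A] have [1 + n] vertices each, and they are disjoint
    because their centres are at distance 3. *)
Lemma card_antipodal (G : graph) (n : nat) (A : set G) :
  antipodal n A -> (A #= `I_(n + n + 2))%card.
Proof.
move=> [[a Aa] An A3 AU]; have [b [ab _]] := A3 a Aa.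
have [[_ Ab] abN nab n2 _] := ab.
have cardU x : A x -> (x |` (A `&` nbr x) #= `I_(1 + n))%card.
  move=> Ax; apply: card_setU_disjoint card_set1 (An _ Ax).
  by apply/seteqP; split=> // _ [-> []] _; rewrite /nbr /= adj_irr.
rewrite (AU _ _ ab) (_ : n + n + 2 = (1 + n) + (1 + n)).
  apply: card_setU_disjoint (cardU _ Aa) (cardU _ Ab).
  apply/seteqP; split=> // z [].
  move=> [->|[Az az]] [zb|[_ bz]].
  - exact: abN.
  - by rewrite /nbr /= adj_sym (negbTE nab) in bz.
  - by rewrite /nbr /= zb (negbTE nab) in az.
  - by move: (n2 z Az az); rewrite adj_sym bz.
by rewrite addnACA addnC.
Qed.

(** The covering clause is where k_1 = k_2 enters. If [y] is the antipode of [x], every neighbour of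
    [y] is at distance 2 from [x]; the two sets have equal size, so [nbr y] is all of
    [sphere 2 x]. *)
Lemma antipodal_diameter3 (D : graph) (n : nat) :
  nonempty_graph D -> diameter D 3 -> has_k D 1 n -> has_k D 2 n ->
  has_k D 3 1 -> antipodal n [set: D].
Proof.
move=> D0 [diam _] k1 k2 k3.
have anti (x : D) : exists! y, dist3 setT x y.
  have [y xE] := card1_set1 (k3 x); exists y; split.
    by apply/at_dist3P; have : [set y] y by []; rewrite -xE.
  by move=> z /at_dist3P xz; have : sphere 3 x z by []; rewrite xE => ->.
split=> // [x _|x y xy].
  by rewrite setTI -sphere1; exact: k1.
have near z : z = x \/ adj x z \/ sphere 2 x z \/ z = y.
  have [[|[|[|[|//]]]] _ xz] := diam x z.
  - by left; case: xz => -[[|? ?] []].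
  - by right; left; have : sphere 1 x z by []; rewrite sphere1.
  - by right; right; left.
  - move/at_dist3P in xz; have [t [_ tU]] := anti x.
    by right; right; right; rewrite -(tU _ xz) (tU _ xy).
have [_ yx nyx n2 _] := dist3_sym xy.
have nbr_y : nbr y = sphere 2 x.
  apply: card_subset_eq (k2 x) => [z yz|]; last by rewrite -sphere1; exact: k1.
  have := n2 z I yz; case: (near z) => [zx|[xz|[//|zy]]].
    by rewrite zx in yz; rewrite yz in nyx.
    by rewrite adj_sym xz.
  by move: yz; rewrite zy /nbr /= adj_irr.
apply/seteqP; split=> // z _; rewrite !setTI nbr_y.
by case: (near z) => [->|[|[|->]]]; [left; left|left; right|right; right|right; left].
Qed.

(** In [D] and in [E] the vertices [c] and [d] have no common neighbour, so the neighbours of [c] in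
    either set avoid the [n] vertices of [N] adjacent to both. Only [n] neighbours of [c] in [N]
    remain, and both sets must contain them all; the same holds for [d]. *)
Lemma antipodal_eq (G : graph) (n : nat) (N D E : set G) (c d : G) :
  antipodal n D -> antipodal n E -> D `<=` N -> E `<=` N ->
  dist3 D c d -> dist3 E c d ->
  (N `&` nbr c #= `I_(n + n))%card -> (N `&` nbr d #= `I_(n + n))%card ->
  (N `&` nbr c `&` nbr d #= `I_n)%card -> D = E.
Proof.
move=> [_ Dn _ DU] [_ En _ EU] DN EN Dcd Ecd Nc Nd Ncd.
rewrite (DU _ _ Dcd) (EU _ _ Ecd).
have nbrE a b : dist3 D a b -> dist3 E a b -> (N `&` nbr a #= `I_(n + n))%card ->
    (N `&` nbr a `&` nbr b #= `I_n)%card -> D `&` nbr a = E `&` nbr a.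
  have disj X : dist3 X a b -> (N `&` nbr a `&` nbr b) `&` (X `&` nbr a) = set0.
    move=> [_ _ _ n2 _]; apply/seteqP; split=> // z [[_ bz] [Xz az]].
    by move: (n2 z Xz az); rewrite adj_sym bz.
  move=> Dab Eab Na Nab; have [[Da _] _ _ _ _] := Dab.
  have [[Ea _] _ _ _ _] := Eab.
  apply: eq_card_complement Na Nab (Dn _ Da) (En _ Ea) _ _ _ (disj _ Dab) (disj _ Eab).
  - exact: subIsetl.
  - exact: setSI.
  - exact: setSI.
rewrite (nbrE c d Dcd Ecd Nc Ncd); rewrite setIAC in Ncd.
by rewrite (nbrE d c (dist3_sym Dcd) (dist3_sym Ecd) Nd Ncd).
Qed.

Lemma at_dist2P (G : graph) (x y z : G) :
  adj x z -> adj z y -> at_dist 2 x y <-> x <> y /\ ~~ adj x y.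
Proof.
move=> xz zy; split=> [[_ n2]|[xy nxy]].
  split=> [xy|]; first by apply: (n2 0) => //; exists [::].
  by apply/negP => xy; apply: (n2 1) => //; exists [:: y]; rewrite /= xy.
split; first by exists [:: z; y]; rewrite /= xz zy.
move=> [|[|]]// _ [[|a [|? ?]] []]//=.
by rewrite andbT => xa ay; rewrite ay (negbTE nxy) in xa.
Qed.

(** * The unique x from conditions on neighbourhoods *)

Section LocallyAntipodal.
Variables (G : graph) (n : nat).

(** These three hypotheses are the properties of Sigma read inside [nbr u]: the shape of its
    mu-graphs, the value of lambda, and condition (iv). *)
Hypothesis mu_antipodal : forall u a b : G, adj u a -> adj u b -> a <> b ->
  ~~ adj a b -> antipodal n (nbr u `&` nbr a `&` nbr b).
Hypothesis card_triangle_nbr : forall u a b : G, adj u a -> adj u b -> adj a b ->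
  (nbr u `&` nbr a `&` nbr b #= `I_(n + n))%card.
Hypothesis swap : forall u a b c d : G, adj u a -> adj u b -> a <> b ->
  ~~ adj a b -> dist3 (nbr u `&` nbr a `&` nbr b) c d ->
  dist3 (nbr u `&` nbr c `&` nbr d) a b.

Lemma unique_x_of_mu_antipodal (u v w : G) :
  adj v u -> adj v w -> u <> w -> ~~ adj u w ->
  exists! x : G, (nbr u `&` sphere 2 v) x /\
    nbr u `&` nbr v `&` nbr w = nbr u `&` nbr v `&` nbr x.
Proof.
move=> vu vw uw nuw; have uv : adj u v by rewrite adj_sym.
(* [D] is first seen as a mu-graph inside [nbr v], where [u] and [w] are not adjacent; the rest of
   the argument takes place inside [nbr u]. *)
have := mu_antipodal vu vw uw nuw; rewrite (setIC (nbr v)).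
set D := _ `&` nbr w => Danti; have [[c Dc] _ anti _] := Danti.
have [d [cdD _]] := anti c Dc.
have [[_ [[ud vd] _]] cd ncd _ _] := cdD; have [[uc vc] _] := Dc.
have Ev : (nbr u `&` nbr c `&` nbr d) v.
  by split; [split|]; rewrite // /nbr /= adj_sym.
have [_ En Eanti _] := mu_antipodal uc ud cd ncd.
have [x [vxE xU]] := Eanti v Ev.
have [[_ [[ux cx] dx]] vx nvx _ _] := vxE.
exists x; split.
  split; first by split=> //; apply/(at_dist2P vu ux).
  apply: (@antipodal_eq _ n (nbr u `&` nbr v)) cdD _ _ _ _ => //.
  - exact: mu_antipodal.
  - exact: subIsetl.
  - exact: (swap uc ud cd ncd vxE).
  - exact: card_triangle_nbr.
  - exact: card_triangle_nbr.
  (* Regrouped, this set consists of the neighbours of [v] in the mu-graph of [c] and [d] inside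
     [nbr u], which has valency [n]. *)
  - by rewrite -setIA setIAC setIA; exact: En.
move=> y [[uy /(at_dist2P vu uy)[vy nvy]] DE]; apply: xU.
by apply: swap => //; rewrite -DE.
Qed.

End LocallyAntipodal.

Theorem lemma4p3 (Gamma Sigma Delta : graph)
  (Gamma0 : nonempty_graph Gamma) (Sigma0 : nonempty_graph Sigma) (Delta0 : nonempty_graph Delta)
  (Gamma_locally : locally Gamma Sigma)
  (Sigma_mu_graphs : mu_graphs_isomorphic_to Sigma Delta)
  (v k lambda mu : nat)
  (Sigma_srg : strongly_regular Sigma v k lambda mu)
  (lambda_mu : mu = lambda + 2)
  (Delta_diameter : diameter Delta 3)
  (Delta_k12 : exists n : nat, has_k Delta 1 n /\ has_k Delta 2 n)
  (Delta_k3 : has_k Delta 3 1)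
  (dist3_swap : forall y z v x : Sigma, y <> z -> ~~ adj y z ->
     at_dist_in (nbr y `&` nbr z) 3 v x -> at_dist_in (nbr v `&` nbr x) 3 y z) :
  unique_x_property Gamma.
Proof.
have [n [k1 k2]] := Delta_k12.
have [Sv /andP[_ kv] Sk Slam Smu] := Sigma_srg.
have anti (y z : Sigma) : y <> z -> ~~ adj y z -> antipodal n (nbr y `&` nbr z).
  (* Since mu is at least 2, a common neighbour exists, so [y] and [z] are at distance 2 and their
     mu-graph is a copy of Delta. *)
  move=> yz nyz; have [t [yt zt]] : nbr y `&` nbr z !=set0.
    by have := Smu y z yz nyz; rewrite lambda_mu addn2 => /card_succ_nonempty.
  have /Sigma_mu_graphs/embedding_of_isomorphic[e eP <-] : at_dist 2 y z.
    by apply/(at_dist2P yt) => //; rewrite adj_sym.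
  by apply: antipodal_embedding => //; exact: antipodal_diameter3.
(* Otherwise a vertex and its [k] neighbours would exhaust Sigma, contradicting [k < v.-1]. *)
have [y [z [yz nyz]]] : exists y z : Sigma, y <> z /\ ~~ adj y z.
  have [y _] := Sigma0; apply: contrapT => H.
  suff yE : [set y] `|` nbr y = [set: Sigma].
    have : ([set: Sigma] #= `I_(1 + k))%card.
      rewrite -yE; apply: card_setU_disjoint card_set1 (Sk y).
      by apply/seteqP; split=> // _ [-> ]; rewrite /nbr /= adj_irr.
    move/(card_eq_trans (card_esym Sv))/card_eq_II => vE.
    by rewrite vE add1n ltnn in kv.
  apply/seteqP; split=> // z _; have [->|yz] := pselect (y = z); first by left.
  by right; apply: contrapT => /negP nyz; apply: H; exists y, z.
(* The order of the mu-graph of [y] and [z] is both [lambda + 2] and [n + n + 2]. *)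
have lambdaE : lambda = n + n.
  have := card_eq_trans (card_esym (Smu y z yz nyz)) (card_antipodal (anti y z yz nyz)).
  by rewrite lambda_mu => /card_eq_II/addIn.
have loc u : exists2 e : Sigma -> Gamma, embedding e & range e = nbr u.
  exact: embedding_of_isomorphic (Gamma_locally u).2.
have locE u (e : Sigma -> Gamma) : embedding e -> range e = nbr u ->
    forall a b, nbr u `&` nbr (e a) `&` nbr (e b) = e @` (nbr a `&` nbr b).
  by move=> eP eu a b; rewrite -eu -!embedding_setI_nbr// setTI.
have locP u a : adj u a -> forall e : Sigma -> Gamma, range e = nbr u ->
    exists a', e a' = a.
  by move=> ua e eu; have : nbr u a by []; rewrite -eu => -[a' _ <-]; exists a'.
(* A non-adjacent pair of Sigma, placed in the neighbourhood of any vertex [o], supplies the triple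
   u, v, w with [o] in the middle, and shows that Gamma is not complete. *)
have [o _] := Gamma0; have [e eP eo] := loc o.
have oe a : adj o (e a) by change (nbr o (e a)); rewrite -eo; exists a.
have eyz : e y <> e z by move/eP.1.
have neyz : ~~ adj (e y) (e z) by rewrite eP.2.
have eyo : adj (e y) o by rewrite adj_sym.
split; first by move=> /(_ _ _ eyz); rewrite (negbTE neyz).
exists (e y), o, (e z); split=> //.
  by split; [apply/(at_dist2P eyo (oe z))|exact: oe].
(* Each local condition is pulled back to Sigma along an embedding [f] onto [nbr u]. *)
apply: (@unique_x_of_mu_antipodal _ n) => //.
- move=> u a b ua ub; have [f fP fu] := loc u.
  have [[a' <-] [b' <-]] := (locP _ _ ua f fu, locP _ _ ub f fu).
  rewrite fP.2 locE// => ab nab.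
  by apply: antipodal_embedding => //; apply: anti => // abE; rewrite abE in ab.
- move=> u a b ua ub; have [f fP fu] := loc u.
  have [[a' <-] [b' <-]] := (locP _ _ ua f fu, locP _ _ ub f fu).
  by rewrite fP.2 locE// card_embedding// -lambdaE => /Slam.
- move=> u a b c d ua ub ab nab abcd; have [f fP fu] := loc u.
  have [[[[uc _] _] [[ud _] _]] _ _ _ _] := abcd.
  move: (locP _ _ ua f fu) (locP _ _ ub f fu) (locP _ _ uc f fu) (locP _ _ ud f fu).
  move=> [a' a'E] [b' b'E] [c' c'E] [d' d'E]; subst a b c d.
  move: abcd; rewrite !locE// => /(embedding_dist3 fP)/at_dist_in3P abcd.
  apply/embedding_dist3 => //; apply/at_dist_in3P/dist3_swap => //.
    by move=> abE; rewrite abE in ab.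
  by rewrite -fP.2.
Qed.
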